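(* Let $\mathcal M_1,\dots,\mathcal M_K$ be first-exit state-action LMDPs on the same finite sets $\mathcal X,\mathcal A$, with the same deterministic state-transition kernel $p_x$, the same passive action kernel $p_a$, the same terminal set $\mathcal T\subset\mathcal X\times\mathcal A$ and the same cost $q$ on non-terminal state-actions, differing only in their terminal costs $f_k:\mathcal T\to[0,\infty]$. Let $c_1,\dots,c_K\ge 0$ be weights with $\sum_k c_k=1$, and let $\mathcal M$ be the composite problem with the same data and terminal cost $$f(y)=-\log\Big(\sum_{k=1}^K c_k\exp(-f_k(y))\Big),\qquad y\in\mathcal T.$$ Let $z_k,u_k^*$ be the optimal desirability function and policy of $\mathcal M_k$, and $z,u^*$ those of $\mathcal M$. Then $$z(x,a)=\sum_{k=1}^K c_k z_k(x,a)\qquad\text{for all }(x,a)\in\mathcal X\times\mathcal A,$$ and for every non-terminal $(x,a)$ with $z(x,a)>0$, the state $x'$ with $p_x(x'|x,a)=1$, and every $a'\in\mathcal A$, $$u^*(a'|x';x,a)=\sum_{k=1}^K m_k(x,a)\,u_k^*(a'|x';x,a),\qquad m_k(x,a)=\frac{c_k z_k(x,a)}{\sum_{n=1}^K c_n z_n(x,a)} .$$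
   Context: A state-action LMDP (saLMDP) consists of finite sets $\mathcal X,\mathcal A$ (states, actions), a state-transition kernel $p_x(x'|x,a)$, a ''passive'' action-transition kernel $p_a(a'|x';x,a)$ (for each $(x',x,a)$ a probability distribution on $a'\in\mathcal A$), and a cost function, here given by $q:(\mathcal X\times\mathcal A)\setminus\mathcal T\to(0,\infty]$ on non-terminal state-actions and a terminal cost on $\mathcal T$. Deterministic $p_x$ means that for each $(x,a)$ there is exactly one $x'$ with $p_x(x'|x,a)=1$. For deterministic $p_x$ and terminal cost $f$, the optimal desirability function of the first-exit problem is the function $z:\mathcal X\times\mathcal A\to[0,\infty)$ determined by $z=\exp(-f)$ on $\mathcal T$ and, for $(x,a)\notin\mathcal T$, $$z(x,a)=\exp(-q(x,a))\sum_{x'}p_x(x'|x,a)\,\mathfrak N[z](x',x,a),\qquad \mathfrak N[z](x',x,a)=\sum_{a'}p_a(a'|x';x,a)\,z(x',a'),$$ with $\exp(-\infty)=0$, $-\log 0=+\infty$. The optimal policy is $u^*(a'|x';x,a)=p_a(a'|x';x,a)\,z(x',a')/\mathfrak N[z](x',x,a)$ whenever $\mathfrak N[z](x',x,a)>0$, and an arbitrary probability distribution otherwise. *)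

(* Defs.v *)
From HB Require Import structures.
From mathcomp Require Import all_boot all_order all_algebra.
From mathcomp Require Import all_classical all_reals all_analysis.

Set Implicit Arguments.
Unset Strict Implicit.
Unset Printing Implicit Defensive.
Import Order.TTheory GRing.Theory Num.Theory.
Local Open Scope ring_scope.

Definition is_distr (R : realType) (I : finType) (p : I -> R) : Prop :=
  (forall i, 0 <= p i) /\ \sum_i p i = 1.

(* All the data of a first-exit state-action LMDP except its terminal cost,
   which is kept apart so that several problems can share the rest.
   [ptrans M x a x'] is p_x(x'|x,a) and [pact M x' x a a'] is p_a(a'|x';x,a).
   [cost M] is only meaningful off [terminal M]. *)
Record saLMDP (R : realType) (X A : finType) := SaLMDP {
  ptrans : X -> A -> X -> R;
  pact : X -> X -> A -> A -> R;
  terminal : {set X * A};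
  cost : X * A -> \bar R;
  ptrans_distr : forall x a, is_distr (ptrans x a);
  pact_distr : forall x' x a, is_distr (pact x' x a);
  cost_gt0 : forall y, y \notin terminal -> (0 < cost y)%E
}.

(* A terminal cost with values in [0, +oo]; its values off the terminal set are
   irrelevant. *)
Definition terminal_cost (R : realType) (X A : finType) (M : saLMDP R X A)
    (f : X * A -> \bar R) : Prop :=
  forall y, y \in terminal M -> (0 <= f y)%E.

Definition deterministic (R : realType) (X A : finType) (M : saLMDP R X A) : Prop :=
  forall x a, exists! x', ptrans M x a x' = 1.

(* N[z](x',x,a) *)
Definition normalizer (R : realType) (X A : finType) (M : saLMDP R X A)
    (z : X * A -> R) (x' x : X) (a : A) : R :=
  \sum_(a' : A) pact M x' x a a' * z (x', a').

(* The equations are stated in \bar R so that infinite costs are handled by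
   [expeR], with expeR -oo = 0. Since costs are positive off the terminal set,
   exp(-cost) < 1 there, so the equations determine z. *)
Definition optimal_desirability (R : realType) (X A : finType) (M : saLMDP R X A)
    (f : X * A -> \bar R) (z : X * A -> R) : Prop :=
  [/\ forall y, 0 <= z y,
      forall y, y \in terminal M -> (z y)%:E = expeR (- f y)%E
    & forall x a, (x, a) \notin terminal M ->
        (z (x, a))%:E =
        (expeR (- cost M (x, a)) *
         (\sum_(x' : X) ptrans M x a x' * normalizer M z x' x a)%R%:E)%E].

(* [u x' x a a'] is u(a'|x';x,a). The optimal policy is not unique: where
   N[z] vanishes any probability distribution is allowed. *)
Definition optimal_policy (R : realType) (X A : finType) (M : saLMDP R X A)
    (z : X * A -> R) (u : X -> X -> A -> A -> R) : Prop :=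
  forall x' x a,
    if 0 < normalizer M z x' x a
    then forall a', u x' x a a' =
           pact M x' x a a' * z (x', a') / normalizer M z x' x a
    else is_distr (u x' x a).

(* - log (sum_k c_k exp(- f_k)), with lne 0 = -oo *)
Definition composite_cost (R : realType) (X A : finType) (K : nat)
    (c : 'I_K -> R) (f : 'I_K -> X * A -> \bar R) (y : X * A) : \bar R :=
  (- lne (\sum_(k < K) (c k)%:E * expeR (- f k y)))%E.

Definition mixing_weight (R : realType) (X A : finType) (K : nat)
    (c : 'I_K -> R) (z : 'I_K -> X * A -> R) (k : 'I_K) (y : X * A) : R :=
  c k * z k y / \sum_(n < K) c n * z n y.

(* Main.v *)
Require Import Defs.
From HB Require Import structures.
From mathcomp Require Import all_boot all_order all_algebra.
From mathcomp Require Import all_classical all_reals all_analysis.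
From mathcomp Require Import ring.
Import Order.TTheory GRing.Theory Num.Theory.
Local Open Scope ring_scope.

Set Implicit Arguments.
Unset Strict Implicit.

(** The optimality equations for [z] are linear in [z] and in the terminal values
    [exp(-f)], and the composite terminal cost is chosen so that
    [exp(-f) = \sum_k c_k exp(-f_k)]; hence [\sum_k c_k z_k] solves the composite
    equations.  Off the terminal set the discount [exp(-q)] is below 1, so the
    equations contract the sup distance and have only one solution.  Where
    [p_x(x'|x,a) = 1] one has [z_k(x,a) = exp(-q(x,a)) N[z_k](x',x,a)], so
    [m_k = c_k N[z_k] / N[z]], and the denominators [N[z_k]] cancel against those
    of the policies [u_k]. *)

(** Averaging does not expand the sup distance. The uniqueness proof uses this twice, for the mean
    over next states and for the mean over next actions. *)
Lemma is_distr_mean_dist (R : realType) (I : finType) (p v w : I -> R) (m : R) :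
  is_distr p -> (forall i, `|v i - w i| <= m) ->
  `|\sum_i p i * v i - \sum_i p i * w i| <= m.
Proof.
move=> [p_ge0 p_sum1] vw.
rewrite -sumrB (le_trans (ler_norm_sum _ _ _))//.
rewrite -[leRHS]mul1r -p_sum1 mulr_suml ler_sum// => i _.
by rewrite -mulrBr normrM ger0_norm// ler_wpM2l.
Qed.

Lemma is_distr_dirac_mean (R : realType) (I : finType) (p v : I -> R) (i : I) :
  is_distr p -> p i = 1 -> \sum_j p j * v j = v i.
Proof.
move=> [p_ge0 p_sum1] pi1.
have p0 j : j != i -> p j = 0.
  apply: (psumr_eq0P (P := fun j => j != i)) => //.
  by apply: (addrI 1); rewrite addr0 -[RHS]p_sum1 [RHS](bigD1 i)//= pi1.
rewrite (bigD1 i)//= pi1 mul1r big1 ?addr0// => j ji.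
by rewrite p0// mul0r.
Qed.

Lemma sume_mul_fin (R : realType) (I : finType) (c v : I -> R) (w : I -> \bar R) :
  (forall i, (v i)%:E = w i) ->
  (\sum_i c i * v i)%:E = (\sum_i (c i)%:E * w i)%E.
Proof.
move=> vw; rewrite -sumEFin.
by apply: eq_bigr => i _; rewrite EFinM vw.
Qed.

(** A real-valued [exp(-q)], so that the equations can be handled by field arithmetic. Off the
    terminal set [fine] loses nothing since the cost is positive there; on it the value carries no
    meaning. *)
Definition discount {R : realType} {X A : finType} (M : saLMDP R X A)
  (y : X * A) : R := fine (expeR (- cost M y)).

Section Desirability.
Context {R : realType} {X A : finType} (M : saLMDP R X A).
Implicit Types (z : X * A -> R) (f : X * A -> \bar R).

Lemma discountE y : y \notin terminal M ->
  (discount M y)%:E = expeR (- cost M y)%E.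
Proof.
move=> /cost_gt0; rewrite /discount.
by case: (cost M y).
Qed.

Lemma discount_ge0 y : 0 <= discount M y.
Proof. by rewrite fine_ge0// expeR_ge0. Qed.

Lemma discount_lt1 y : y \notin terminal M -> discount M y < 1.
Proof.
move=> yT; rewrite -lte_fin discountE// -expeR0 lte_expeR.
by rewrite oppe_lt0 cost_gt0.
Qed.

Lemma normalizer_ge0 z x' x a : (forall y, 0 <= z y) ->
  0 <= normalizer M z x' x a.
Proof.
move=> z_ge0; have [p_ge0 _] := pact_distr M x' x a.
by apply: sumr_ge0 => a' _; rewrite mulr_ge0.
Qed.

Lemma normalizer_eq0 z x' x a a' : (forall y, 0 <= z y) ->
  normalizer M z x' x a = 0 -> pact M x' x a a' * z (x', a') = 0.
Proof.
move=> z_ge0 N0; have [p_ge0 _] := pact_distr M x' x a.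
by apply: (psumr_eq0P _ N0) => // b _; rewrite mulr_ge0.
Qed.

Lemma normalizer_lincomb (I : finType) (c : I -> R) (zk : I -> X * A -> R) x' x a :
  normalizer M (fun y => \sum_k c k * zk k y) x' x a =
  \sum_k c k * normalizer M (zk k) x' x a.
Proof.
rewrite /normalizer; under eq_bigr do rewrite mulr_sumr.
rewrite exchange_big; apply: eq_bigr => k _.
by rewrite mulr_sumr; apply: eq_bigr => a' _; rewrite mulrCA.
Qed.

Lemma desirability_step f z x a : optimal_desirability M f z ->
  (x, a) \notin terminal M ->
  z (x, a) = discount M (x, a) * \sum_x' ptrans M x a x' * normalizer M z x' x a.
Proof.
move=> [_ _ zN] xaT; apply: EFin_inj.
by rewrite EFinM discountE// zN.
Qed.

Lemma optimal_desirability_unique f z1 z2 :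
  optimal_desirability M f z1 -> optimal_desirability M f z2 -> z1 =1 z2.
Proof.
move=> z1_opt z2_opt y0.
(* As [X * A] is finite, the sup distance [m] is attained, at some [y]; the point [y0] shows that
   the type is inhabited. *)
have [y _ ymax] := arg_maxP (fun y => `|z1 y - z2 y|) (erefl : xpredT y0).
set m := `|z1 y - z2 y| in ymax.
suff m0 : m = 0.
  by apply/eqP; rewrite -subr_eq0 -normr_le0 -m0; exact: ymax.
have [yT|] := boolP (y \in terminal M).
  have [_ z1T _] := z1_opt; have [_ z2T _] := z2_opt.
  have z12 : z1 y = z2 y by apply: EFin_inj; rewrite z1T// z2T.
  by rewrite /m z12 subrr normr0.
rewrite /m; case: y @m ymax => x a m ymax xaT.
have m_le : m <= discount M (x, a) * m.
  rewrite {1}/m (desirability_step z1_opt)// (desirability_step z2_opt)//.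
  rewrite -mulrBr normrM (ger0_norm (discount_ge0 _)).
  rewrite ler_wpM2l ?discount_ge0//.
  apply: is_distr_mean_dist => [|x']; first exact: ptrans_distr.
  apply: is_distr_mean_dist => [|a']; first exact: pact_distr.
  exact: ymax.
(* From [m <= b * m] with [b < 1] follows [(1 - b) * m <= 0], hence [m <= 0]. *)
apply/eqP; rewrite eq_le normr_ge0 andbT -/m.
have b1 : 0 < 1 - discount M (x, a) by rewrite subr_gt0 discount_lt1.
by rewrite -(pmulr_rle0 _ b1) mulrBl mul1r subr_le0.
Qed.

Lemma composite_desirability (K : nat) (f : 'I_K -> X * A -> \bar R)
    (c : 'I_K -> R) (zk : 'I_K -> X * A -> R) :
  (forall k, 0 <= c k) -> (forall k, optimal_desirability M (f k) (zk k)) ->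
  optimal_desirability M (composite_cost c f)
    (fun y => \sum_(k < K) c k * zk k y).
Proof.
move=> c_ge0 zk_opt; split=> [y|y yT|x a xaT].
- apply: sumr_ge0 => k _; have [zk_ge0 _ _] := zk_opt k.
  by rewrite mulr_ge0.
- rewrite /composite_cost oppeK.
  have E : (\sum_(k < K) c k * zk k y)%:E =
           (\sum_(k < K) (c k)%:E * expeR (- f k y))%E.
    by apply: sume_mul_fin => k; have [_ zkT _] := zk_opt k; rewrite zkT.
  (* [expeR] inverts [lne] on all of [[0, +oo]]. This covers a zero sum, where the composite cost is
     [+oo]. *)
  rewrite E; apply/esym/eqP; rewrite lneK_eq.
  by apply: sume_ge0 => k _; rewrite mule_ge0 ?lee_fin ?expeR_ge0.
- rewrite -discountE// -EFinM; congr EFin.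
  under eq_bigr do rewrite (desirability_step (zk_opt _) xaT) mulrCA.
  rewrite -mulr_sumr; congr (_ * _).
  under [RHS]eq_bigr do rewrite normalizer_lincomb mulr_sumr.
  rewrite exchange_big; apply: eq_bigr => k _.
  by rewrite mulr_sumr; apply: eq_bigr => x' _; rewrite mulrCA.
Qed.

Lemma desirability_dirac_step f z x a x' : optimal_desirability M f z ->
  (x, a) \notin terminal M -> ptrans M x a x' = 1 ->
  z (x, a) = discount M (x, a) * normalizer M z x' x a.
Proof.
move=> z_opt xaT px1; rewrite (desirability_step z_opt)//.
by rewrite (is_distr_dirac_mean _ (ptrans_distr _ _ _) px1).
Qed.

(* Also true at [N[z] = 0], where [u] is arbitrary but both sides vanish. *)
Lemma optimal_policy_normalizer z u x' x a a' : (forall y, 0 <= z y) ->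
  optimal_policy M z u ->
  normalizer M z x' x a * u x' x a a' = pact M x' x a a' * z (x', a').
Proof.
move=> z_ge0 /(_ x' x a); case: ifPn => [N_gt0 ->|].
  by rewrite mulrC divfK// gt_eqF.
rewrite -leNgt => N_le0 _.
have N0 : normalizer M z x' x a = 0.
  by apply/eqP; rewrite eq_le N_le0 normalizer_ge0.
by rewrite N0 mul0r normalizer_eq0.
Qed.

End Desirability.

Theorem mainTheorem3 (R : realType) (X A : finType) (M : saLMDP R X A)
    (K : nat) (f : 'I_K -> X * A -> \bar R) (c : 'I_K -> R)
    (zk : 'I_K -> X * A -> R) (uk : 'I_K -> X -> X -> A -> A -> R)
    (z : X * A -> R) (u : X -> X -> A -> A -> R)
    (M_det : deterministic M)
    (f_terminal : forall k, terminal_cost M (f k))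
    (c_ge0 : forall k, 0 <= c k) (c_sum1 : \sum_(k < K) c k = 1)
    (zk_opt : forall k, optimal_desirability M (f k) (zk k))
    (uk_opt : forall k, optimal_policy M (zk k) (uk k))
    (z_opt : optimal_desirability M (composite_cost c f) z)
    (u_opt : optimal_policy M z u) :
  (forall x a, z (x, a) = \sum_(k < K) c k * zk k (x, a)) /\
  (forall x a, (x, a) \notin terminal M -> 0 < z (x, a) ->
   forall x', ptrans M x a x' = 1 ->
   forall a', u x' x a a' =
     \sum_(k < K) mixing_weight c zk k (x, a) * uk k x' x a a').
Proof.
have zE y : z y = \sum_(k < K) c k * zk k y.
  exact: (optimal_desirability_unique z_opt
    (composite_desirability c_ge0 zk_opt)).
split=> [x a|x a xaT z_gt0 x' px1 a']; first exact: zE.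
have z_step := desirability_dirac_step z_opt xaT px1.
have [z_ge0 _ _] := z_opt.
(* Since [z (x, a)] is the product of the discount and [N[z]], its positivity makes both factors
   nonzero. *)
have b_neq0 : discount M (x, a) != 0.
  by apply: contraTneq z_gt0 => b0; rewrite z_step b0 mul0r ltxx.
have N_neq0 : normalizer M z x' x a != 0.
  by apply: contraTneq z_gt0 => N0; rewrite z_step N0 mulr0 ltxx.
(* Clearing [N[z]] turns the left side into [p_a * z], which is linear in [z], so the claim can be
   checked for each [k] separately. *)
apply: (mulfI N_neq0).
rewrite (optimal_policy_normalizer _ _ _ _ z_ge0 u_opt) zE !mulr_sumr.
apply: eq_bigr => k _; have [zk_ge0 _ _] := zk_opt k.
rewrite /mixing_weight -zE z_step.
rewrite (desirability_dirac_step (zk_opt k) xaT px1).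
(* Writing [p_a * z_k] as [N[z_k] * u_k] avoids dividing by [N[z_k]], which may vanish for some [k].
   Only the common discount and [N[z]] remain to be cancelled. *)
rewrite mulrCA -(optimal_policy_normalizer _ _ _ a' zk_ge0 (uk_opt k)).
by field; rewrite N_neq0.
Qed.
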